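(* If $\alpha$ is an algebraic integer all of whose conjugates have modulus greater than $2$, then $\alpha\in\mathcal{F}_{|M_\alpha(0)|}$.
   Context: For $S\subset\mathbb{C}$ and $\alpha\in\mathbb{C}$, $S[\alpha]:=\{\sum_{j=0}^n f_j\alpha^j : n\in\mathbb{N},\ (f_0,\ldots,f_n)\in S^{n+1}\}$. For an algebraic number $\alpha$, $M_\alpha\in\mathbb{Z}[x]$ is its primitive minimal polynomial over $\mathbb{Q}$; conjugates are over $\mathbb{Q}$ and include $\alpha$. For an algebraic number $\alpha$ for which some finite $S\subset\mathbb{C}$ satisfies $\mathbb{Z}[\alpha]=S[\alpha]$, let $S_\alpha$ denote such a finite set of minimal cardinality; for $N\in\mathbb{N}$, $\mathcal{F}_N$ is the set of algebraic numbers $\alpha$ for which such a set exists and $\operatorname{Card}(S_\alpha)=N$. *)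

(* Defs.v *)
From HB Require Import structures.
From mathcomp Require Import all_boot all_order all_algebra.
From mathcomp Require Import finmap complex.
From mathcomp Require Import boolp classical_sets reals.

Set Implicit Arguments.
Unset Strict Implicit.
Unset Printing Implicit Defensive.

Import Order.TTheory GRing.Theory Num.Theory.

Local Open Scope classical_set_scope.
Local Open Scope ring_scope.

(* Throughout, the field of complex numbers is R[i] for R : realType. *)

Definition algebraic_number (R : realType) (alpha : R[i]) : Prop :=
  algebraicOver (ratr : rat -> R[i]) alpha.

Definition algebraic_integer (R : realType) (alpha : R[i]) : Prop :=
  integralOver (intr : int -> R[i]) alpha.

Definition adjoin (R : realType) (S : set R[i]) (alpha : R[i]) : set R[i] :=
  [set z | exists (n : nat) (f : 'I_n.+1 -> R[i]),
     (forall j, S (f j)) /\ z = \sum_(j < n.+1) f j * alpha ^+ j].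

Definition complex_int (R : realType) : set R[i] :=
  range (intr : int -> R[i]).

(* zcontents carries the sign of the leading coefficient, so zcontents p = 1
   says that p is primitive and has a positive leading coefficient. *)
Definition is_primitive_minpoly (R : realType) (alpha : R[i])
    (p : {poly int}) : Prop :=
  [/\ zcontents p = 1,
      root (map_poly intr p) alpha
    & forall q : {poly rat}, q != 0 -> root (map_poly ratr q) alpha ->
        (size p <= size q)%N].

(* Has the junk value 0 when alpha is not algebraic. *)
Definition primitive_minpoly (R : realType) (alpha : R[i]) : {poly int} :=
  xget 0 [set p | is_primitive_minpoly alpha p].

Definition conjugate (R : realType) (alpha beta : R[i]) : Prop :=
  root (map_poly intr (primitive_minpoly alpha)) beta.

Definition generates (R : realType) (alpha : R[i]) (S : {fset R[i]}) : Prop :=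
  adjoin (@complex_int R) alpha = adjoin [set` S] alpha.

Definition calF (R : realType) (N : nat) : set R[i] :=
  [set alpha | algebraic_number alpha /\
     exists S : {fset R[i]},
       [/\ generates alpha S,
           forall T : {fset R[i]}, generates alpha T -> (#|` S| <= #|` T|)%N
         & #|` S| = N]].

Lemma map_poly_ratr_intr (R : realType) (p : {poly int}) :
  map_poly (ratr : rat -> R[i]) (map_poly intr p) = map_poly intr p.
Proof. by rewrite -map_poly_comp; apply: eq_map_poly => x /=; rewrite ratr_int. Qed.

Lemma primitive_minpoly_exists (R : realType) (alpha : R[i]) :
  algebraic_number alpha -> exists p, is_primitive_minpoly alpha p.
Proof.
case=> q0 nzq0 rq0.
pose P n := `[< exists q : {poly rat},
  [/\ q != 0, root (map_poly ratr q) alpha & size q = n] >].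
have exP : exists n, P n by exists (size q0); apply/asboolP; exists q0.
case: (ex_minnP exP) => m /asboolP[q [nzq rq sq]] min_m.
have [p [a nza Dq]] := rat_poly_scale q.
have nzaQ : (a%:~R : rat) != 0 by rewrite intr_eq0.
have Dp : map_poly intr p = a%:~R *: q by rewrite Dq scalerA divff // scale1r.
have nzp : p != 0.
  apply: contra_neq nzq => p0.
  by rewrite Dq p0 map_poly0 scaler0.
have nzc : (zcontents p)%:~R != 0 :> R[i] by rewrite intr_eq0 zcontents_eq0.
exists (zprimitive p); split.
- by rewrite zcontents_primitive nzp.
- rewrite -(rootZ _ _ nzc) -map_polyZ -zpolyEprim -map_poly_ratr_intr Dp.
  by rewrite map_polyZ rootZ ?fmorph_eq0.
- move=> r nzr rr; rewrite size_zprimitive.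
  have -> : size p = m.
    rewrite -sq -(size_scale q nzaQ) -Dp size_map_inj_poly //.
    exact: intr_inj.
  by apply: min_m; apply/asboolP; exists r.
Qed.

Lemma is_primitive_minpoly_inj (R : realType) (alpha : R[i]) (p q : {poly int}) :
  is_primitive_minpoly alpha p -> is_primitive_minpoly alpha q -> p = q.
Proof.
move=> [cp rp mp] [cq rq mq].
have nz (r : {poly int}) : zcontents r = 1 -> r != 0.
  by move=> cr; rewrite -zcontents_eq0 cr.
have toQ (r : {poly int}) : size (map_poly intr r : {poly rat}) = size r.
  by rewrite size_map_inj_poly //; exact: intr_inj.
have le (p1 p2 : {poly int}) : is_primitive_minpoly alpha p1 ->
    p2 != 0 -> root (map_poly intr p2) alpha -> (size p1 <= size p2)%N.
  move=> [_ _ m1] nz2 r2; rewrite -(toQ p2); apply: m1.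
    by rewrite -size_poly_eq0 toQ size_poly_eq0.
  by rewrite map_poly_ratr_intr.
have Esz : size p = size q.
  by apply/eqP; rewrite eqn_leq !le ?nz.
pose d := lead_coef q *: p - lead_coef p *: q.
have rd : root (map_poly intr d) alpha.
  rewrite rmorphB /= !map_polyZ /root !hornerE.
  by rewrite (rootP rp) (rootP rq) !mulr0 subrr.
have szd : (size d < size p)%N.
  have szp : (0 < size p)%N by rewrite size_poly_gt0 nz.
  rewrite -(prednK szp) ltnS; apply/leq_sizeP => j.
  rewrite leq_eqVlt => /predU1P[<-|lt].
    by rewrite !coefE {2}Esz -/(lead_coef q) -/(lead_coef p) mulrC subrr.
  by rewrite !coefE !nth_default ?mulr0 ?subrr // -?Esz -(prednK szp).
have d0 : d = 0.
  apply/eqP; apply: contraTT szd => nzd; rewrite -leqNgt.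
  exact: le.
have E : lead_coef q *: p = lead_coef p *: q by apply/eqP; rewrite -subr_eq0 -/d d0.
have := congr1 zcontents E; rewrite !zcontentsZ cp cq !mulr1 => El.
by move: E; rewrite El -!mul_polyC; apply: mulfI; rewrite polyC_eq0 lead_coef_eq0 nz.
Qed.

Lemma primitive_minpolyP (R : realType) (alpha : R[i]) :
  algebraic_number alpha -> is_primitive_minpoly alpha (primitive_minpoly alpha).
Proof.
move=> /primitive_minpoly_exists[p pP].
by rewrite /primitive_minpoly; case: xgetP => [q -> //|/(_ p)].
Qed.

Lemma algebraic_integer_number (R : realType) (alpha : R[i]) :
  algebraic_integer alpha -> algebraic_number alpha.
Proof.
case=> p mon_p rp; exists (map_poly intr p); last by rewrite map_poly_ratr_intr.
by rewrite monic_neq0 // monic_map.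
Qed.

(* Main.v *)
Require Import Defs.
From mathcomp Require Import all_boot all_order all_algebra all_field.
From mathcomp Require Import finmap complex.
From mathcomp Require Import boolp classical_sets reals.
From mathcomp Require Import ring.

Import Order.TTheory GRing.Theory Num.Theory.

Local Open Scope ring_scope.

(** Let M be the minimal polynomial of alpha and, for g in Z[X], let N g be the
    sum of |g(beta)| over the roots beta of M. As these roots are distinct, N
    bounds the coefficients of g mod M, so N takes finitely many values below
    any bound and N-descent terminates. For each residue r modulo M(0), take as
    digit some d_r in Z[X] of minimal N among the polynomials g such that
    g(0) = r mod M(0). Given g with residue r, write g = d_r + k M + X h.
    Unless N h = 0, the hypothesis |beta| > 2 gives
    2 N h < N (X h) <= N g + N d_r <= 2 N g, and the descent expands g(alpha) in
    the digits d_r(alpha). Conversely, two integers with the same first digit in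
    a generating set are congruent modulo alpha, hence modulo M(0), so at least
    |M(0)| digits are needed. *)

(** * Finiteness and counting tools *)

(** The Vandermonde matrix of distinct points is invertible, and its inverse recovers the
    coefficients from the values. [K] is the sum of the moduli of the entries of this inverse. *)
Lemma coef_le_sum_values (F : numFieldType) (rs : seq F) : uniq rs ->
  exists2 K : F, 0 <= K & forall (p : {poly F}) (k : nat),
    (size p <= size rs)%N -> `|p`_k| <= K * \sum_(z <- rs) `|p.[z]|.
Proof.
move=> urs; set n := size rs.
pose V := Vandermonde n (\row_(j < n) rs`_j); pose W := invmx V.
have Vu : V \in unitmx.
  rewrite unitmxE det_Vandermonde unitfE.
  apply/prodf_neq0 => i _; apply/prodf_neq0 => j ltij.
  by rewrite !mxE subr_eq0 nth_uniq // neq_ltn ltij orbT.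
exists (\sum_i \sum_j `|W i j|) => [|p k szp].
  by apply: sumr_ge0 => i _; apply: sumr_ge0.
have sum0 : 0 <= \sum_(z <- rs) `|p.[z]| by apply: sumr_ge0.
have K0 : 0 <= \sum_i \sum_j `|W i j|.
  by apply: sumr_ge0 => i _; apply: sumr_ge0.
have [ltkn|lenk] := ltnP k n; last first.
  by rewrite nth_default ?normr0 ?mulr_ge0 // (leq_trans szp).
pose v := \row_(j < n) p`_j; pose w := \row_(j < n) p.[rs`_j].
have vV : v *m V = w.
  apply/rowP => j; rewrite !mxE (horner_coef_wide _ szp).
  by apply: eq_bigr => i _; rewrite !mxE.
have -> : p`_k = (w *m W) 0 (Ordinal ltkn).
  by rewrite -vV mulmxK // mxE.
rewrite mxE (le_trans (ler_norm_sum _ _ _)) //.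
rewrite (big_nth 0) big_mkord -/n mulr_sumr ler_sum // => i _.
rewrite mxE normrM mulrC ler_wpM2r //.
(* A single entry of [W] is bounded by the sum over all entries. *)
rewrite (bigD1 i) //= (bigD1 (Ordinal ltkn)) //= -addrA lerDl.
by rewrite addr_ge0 // ?sumr_ge0 // => j _; apply: sumr_ge0.
Qed.

(** Shifting each coefficient by [b] puts it in the range from 0 to [b + b], so finite functions
    enumerate these polynomials. The domain ['I_n.+1] is never empty, as [inord] requires. *)
Lemma bounded_int_poly_finite (n b : nat) :
  exists L : seq {poly int}, forall g : {poly int},
    (size g <= n)%N -> (forall k, `|g`_k| <= b%:Z) -> g \in L.
Proof.
pose F (f : {ffun 'I_n.+1 -> 'I_(b + b).+1}) : {poly int} :=
  \poly_(i < n.+1) ((f (inord i) : nat)%:Z - b%:Z).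
exists [seq F f | f : {ffun 'I_n.+1 -> 'I_(b + b).+1}] => g szg bg.
apply/mapP; exists [ffun i : 'I_n.+1 => inord (absz (g`_i + b%:Z))].
  by rewrite mem_enum.
apply/polyP => k; rewrite coef_poly; case: ltnP => [ltkn|]; last first.
  by move=> lenk; rewrite nth_default // (leq_trans szg) ?(ltnW lenk).
have := bg k; rewrite ler_norml => /andP[ge le].
have ge0 : 0 <= g`_k + b%:Z by rewrite -lerBlDr sub0r.
rewrite ffunE inordK // inordK ?gez0_abs ?addrK //.
by rewrite ltnS -lez_nat gez0_abs // PoszD lerD2r.
Qed.

Lemma ltn_count (T : eqType) (a b : pred T) (s : seq T) (x : T) :
  subpred a b -> x \in s -> b x -> ~~ a x -> (count a s < count b s)%N.
Proof.
move=> sab xs bx nax.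
rewrite (permP (perm_to_rem xs) a) (permP (perm_to_rem xs) b) /= bx (negPf nax).
by rewrite ltnS sub_count.
Qed.

(** A nonnegative element of [R[i]] is real, so the Archimedean property applies to its real
    part. *)
Lemma complex_nat_bound (R : realType) (x : R[i]) :
  0 <= x -> exists b : nat, x <= b%:R.
Proof.
move=> x0; have: 0 <= complex.Re x by move: x0; rewrite lecE => /andP[].
move=> /archi_boundP/ltW bx; exists (Num.bound (complex.Re x)).
have -> : x = (complex.Re x)%:C%C by rewrite -(RRe_real (ger0_real x0)).
by rewrite -(rmorph_nat (real_complex R)) lecR.
Qed.

(** * The norm N and its well-founded descent *)

Section ConjugateNorm.
Context {R : realType}.
Implicit Types (rs : seq R[i]) (g h M : {poly int}).

Definition conj_norm rs g : R[i] :=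
  \sum_(z <- rs) `|(map_poly intr g).[z]|.

Lemma conj_norm_ge0 rs g : 0 <= conj_norm rs g.
Proof. exact: sumr_ge0. Qed.

Lemma conj_norm_eq0 rs g z :
  conj_norm rs g = 0 -> z \in rs -> (map_poly intr g).[z] = 0.
Proof.
move=> /eqP; rewrite psumr_eq0 // => /allP g0 zrs.
by apply/eqP; have := g0 z zrs; rewrite normr_eq0.
Qed.

Lemma conj_norm_mod M rs g : M \is monic ->
  map_poly intr M = \prod_(z <- rs) ('X - z%:P) :> {poly R[i]} ->
  conj_norm rs (Pdiv.Ring.rmodp g M) = conj_norm rs g.
Proof.
move=> monM DM; rewrite {2}(Pdiv.RingMonic.rdivp_eq monM g).
apply: eq_big_seq => z zrs.
have /rootP Mz0 : root (map_poly intr M : {poly R[i]}) z.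
  by rewrite DM root_prod_XsubC.
by rewrite rmorphD rmorphM /= !hornerE Mz0 mulr0 add0r.
Qed.

Lemma conj_norm_wf M rs : M \is monic -> uniq rs ->
  map_poly intr M = \prod_(z <- rs) ('X - z%:P) :> {poly R[i]} ->
  well_founded (fun g h => conj_norm rs g < conj_norm rs h).
Proof.
move=> monM urs DM g0.
have [K K0 Kb] := coef_le_sum_values _ _ urs.
have [b bP] := complex_nat_bound R (K * conj_norm rs g0)
  (mulr_ge0 K0 (conj_norm_ge0 _ _)).
have [L LP] := bounded_int_poly_finite (size rs) b.
have szM : size M = (size rs).+1.
  rewrite -(size_prod_XsubC rs id) -DM size_map_inj_poly //; exact: intr_inj.
have inL h : conj_norm rs h <= conj_norm rs g0 -> Pdiv.Ring.rmodp h M \in L.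
  move=> leh; have szh : (size (Pdiv.Ring.rmodp h M) <= size rs)%N.
    by rewrite -ltnS -szM Pdiv.Ring.ltn_rmodp monic_neq0.
  apply: LP => // k; rewrite -(ler_int R[i]) intr_norm.
  rewrite (le_trans _ bP) // (le_trans _ (ler_wpM2l K0 leh)) //.
  rewrite -(conj_norm_mod _ _ h monM DM) -coef_map /=; apply: Kb.
  by rewrite size_map_inj_poly //; exact: intr_inj.
(* Induction on the number of elements of [L] whose norm is below that of [g]. Passing to [h] of
   smaller norm loses at least [h] mod [M], which lies in [L] and has the same norm as [h]. *)
suff descent n g : conj_norm rs g <= conj_norm rs g0 ->
    (count (fun p => conj_norm rs p < conj_norm rs g)%R L < n)%N ->
    Acc (fun p q => conj_norm rs p < conj_norm rs q) g.
  by apply: descent (lexx _) (ltnSn _).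
elim: n g => [|n IH] g leg ltn; first by rewrite ltn0 in ltn.
constructor => h lthg.
have leh : conj_norm rs h <= conj_norm rs g0 by exact: le_trans (ltW lthg) leg.
apply: (IH _ leh); rewrite -ltnS; apply: leq_ltn_trans ltn.
apply: (@ltn_count _ _ _ _ _ _ (inL h leh)) => [p||] /=.
- by move/lt_trans; apply.
- by rewrite (conj_norm_mod _ _ _ monM DM).
- by rewrite (conj_norm_mod _ _ _ monM DM) ltxx.
Qed.

End ConjugateNorm.

(** * Divisibility, monicity and separability of the minimal polynomial *)

Section MinimalPolynomial.
Context {R : realType} {alpha : R[i]}.
Hypothesis alpha_alg : algebraic_number alpha.
Local Notation M := (primitive_minpoly alpha).

Lemma minpoly_neq0 : M != 0.
Proof.
by have [cM _ _] := primitive_minpolyP alpha_alg; rewrite -zcontents_eq0 cM.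
Qed.

Lemma minpoly_rat_dvdp (q : {poly rat}) :
  root (map_poly ratr q) alpha -> map_poly intr M %| q.
Proof.
move=> rq; have [_ rM minM] := primitive_minpolyP alpha_alg.
have szM : size (map_poly intr M : {poly rat}) = size M.
  by rewrite size_map_inj_poly //; exact: intr_inj.
have nzM : map_poly intr M != 0 :> {poly rat}.
  by rewrite -size_poly_eq0 szM size_poly_eq0 minpoly_neq0.
have : (size (q %% map_poly intr M)%R < size (map_poly intr M : {poly rat}))%N.
  by rewrite ltn_modp.
apply: contraTT => ndvd; rewrite szM -leqNgt; apply: minM => //.
have:= congr1 (map_poly (ratr : rat -> R[i])) (divp_eq q (map_poly intr M)).
rewrite rmorphD rmorphM /= map_poly_ratr_intr => Dq.
move: rq; by rewrite Dq /root !hornerE (rootP rM) mulr0 add0r.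
Qed.

(** Gauss's lemma: since [M] is primitive, divisibility over the rationals descends to the
    integers. *)
Lemma minpoly_int_dvdp (g : {poly int}) :
  root (map_poly intr g) alpha -> exists q, g = M * q.
Proof.
rewrite -map_poly_ratr_intr => /minpoly_rat_dvdp.
rewrite dvdp_rat_int => /dvdpP_int[q Dg]; exists q.
have [cM _ _] := primitive_minpolyP alpha_alg.
by rewrite Dg {2}[M]zpolyEprim cM scale1r.
Qed.

(** [M] divides a monic integer polynomial, so its leading coefficient is a unit; the sign
    convention of [zcontents] excludes -1. *)
Lemma minpoly_monic : algebraic_integer alpha -> M \is monic.
Proof.
move=> [p /monicP monp /minpoly_int_dvdp[q Dp]].
have [cM _ _] := primitive_minpolyP alpha_alg.
have lM_gt0 : 0 < lead_coef M by rewrite -sgz_gt0 -sgz_contents cM.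
move: monp; rewrite Dp lead_coefM => lMq.
have /intUnitRing.unitzPl : lead_coef q * lead_coef M = 1 by rewrite mulrC.
by move: lM_gt0 => + /orP[]/eqP lM; rewrite monicE lM.
Qed.

Lemma minpoly_rat_irreducible :
  irreducible_poly (map_poly intr M : {poly rat}).
Proof.
set MQ := map_poly intr M.
have [_ rM _] := primitive_minpolyP alpha_alg.
have nzM : MQ != 0.
  by rewrite map_poly_eq0_id0 ?intr_eq0 ?lead_coef_eq0 ?minpoly_neq0.
have rMQ : root (map_poly ratr MQ) alpha by rewrite map_poly_ratr_intr.
split=> [|q szq qM].
  rewrite -(size_map_poly (ratr : {rmorphism rat -> R[i]})).
  by rewrite (root_size_gt1 _ rMQ) // map_poly_eq0.
have [r DM] := dvdpP _ _ qM.
move: rMQ; rewrite {1}DM rmorphM rootM => /orP[/minpoly_rat_dvdp MdvdR|].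
  have nzr : r != 0 by apply: contraNneq nzM => r0; rewrite DM r0 mul0r.
  have nzq : q != 0 by apply: contraNneq nzM => q0; rewrite DM q0 mulr0.
  (* As [q] is not constant, the cofactor [r] has smaller degree than [M], so [M] cannot divide
     it. *)
  have := dvdp_leq nzr MdvdR; rewrite -/MQ DM size_mul //.
  move: szq nzq nzr; rewrite -!size_poly_gt0.
  case: (size q) (size r) => [|[|m]] [|n] //= _ _ _.
  by rewrite !addnS ltnNge leq_addr.
by move=> /minpoly_rat_dvdp MdvdQ; rewrite /eqp qM.
Qed.

(** Over the rationals, [M] is irreducible and its derivative is nonzero of smaller degree, hence
    coprime to it. Separability is preserved by field extension. *)
Lemma minpoly_separable : separable_poly (map_poly intr M : {poly R[i]}).
Proof.
rewrite -map_poly_ratr_intr separable_map.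
have irrM := minpoly_rat_irreducible; have [szM _] := irrM.
set MQ := map_poly intr M in irrM szM *.
rewrite unlock /separable_poly.body irreducible_poly_coprime //.
have nzM' : MQ^`() != 0.
  apply/eqP => /(congr1 (fun p : {poly rat} => p`_(size MQ).-2)) /eqP.
  have szM1 : (0 < (size MQ).-1)%N by rewrite -ltnS (ltn_predK szM).
  rewrite coef_deriv coef0 (prednK szM1) mulrn_eq0 -lead_coefE lead_coef_eq0.
  by rewrite -size_poly_eq0 (gtn_eqF szM1) gtn_eqF // ltnW.
apply: contraL (lt_size_deriv (p := MQ) _) => [/(dvdp_leq nzM')|].
  by rewrite -leqNgt.
by rewrite -size_poly_gt0 ltnW.
Qed.

End MinimalPolynomial.

(** * Expansions in powers of alpha *)

Section DigitExpansions.
Context {R : realType}.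
Implicit Types (alpha z d : R[i]) (S : set R[i]) (g h : {poly int}).

Lemma adjoin1 S alpha d : S d -> adjoin S alpha d.
Proof.
by move=> Sd; exists 0, (fun=> d); split=> //; rewrite big_ord1 expr0 mulr1.
Qed.

Lemma adjoin_cons S alpha d z :
  S d -> adjoin S alpha z -> adjoin S alpha (d + alpha * z).
Proof.
move=> Sd [n [f [Sf ->]]].
exists n.+1, (fun j => oapp f d (unlift ord0 j)); split=> [j|].
  by case: (unlift _ _) => [k|] /=.
rewrite [RHS]big_ord_recl unlift_none /= expr0 mulr1 mulr_sumr; congr (_ + _).
by apply: eq_bigr => j _; rewrite liftK /= exprS mulrCA.
Qed.

Lemma adjoin_intP alpha z :
  adjoin (@complex_int R) alpha z <->
  exists g, z = (map_poly intr g).[alpha].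
Proof.
split=> [[n [f [fZ ->]]]|[g ->]].
  have /choice[a aP] j : exists k : int, k%:~R = f j.
    by have [k _ fk] := fZ j; exists k.
  exists (\sum_(j < n.+1) a j *: 'X^j).
  rewrite rmorph_sum horner_sum; apply: eq_bigr => j _ /=.
  by rewrite map_polyZ map_polyXn hornerZ hornerXn /= aP.
exists (size g), (fun j => (g`_j)%:~R); split=> [j|]; first by exists g`_j.
rewrite (@horner_coef_wide _ (size g).+1); last first.
  by rewrite (leq_trans (size_poly _ _)).
by apply: eq_bigr => j _; rewrite coef_map.
Qed.

(** The digits are themselves integer polynomials in [alpha], so everything after the first one is
    [alpha] times such a polynomial. *)
Lemma adjoin_first_digit S alpha :
  (forall d, S d -> adjoin (@complex_int R) alpha d) ->
  forall z, adjoin S alpha z -> exists d, S d /\ exists h,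
    z = d + alpha * (map_poly intr h).[alpha].
Proof.
move=> SZ z [n [f [Sf ->]]]; exists (f ord0); split=> //.
have /choice[p pP] j : exists g, f j = (map_poly intr g).[alpha].
  by apply/adjoin_intP/SZ.
exists (\sum_(j < n) p (lift ord0 j) * 'X^j).
rewrite big_ord_recl expr0 mulr1; congr (_ + _).
rewrite rmorph_sum horner_sum mulr_sumr; apply: eq_bigr => j _ /=.
by rewrite rmorphM /= map_polyXn hornerM hornerXn -pP exprS mulrCA.
Qed.

Lemma adjoin_intS S alpha :
  (forall d, S d -> adjoin (@complex_int R) alpha d) ->
  forall z, adjoin S alpha z -> adjoin (@complex_int R) alpha z.
Proof.
move=> SZ z /(adjoin_first_digit S alpha SZ)[d [/SZ/adjoin_intP[g ->] [h ->]]].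
apply/adjoin_intP; exists (g + 'X * h).
by rewrite rmorphD rmorphM /= map_polyX !hornerE.
Qed.

End DigitExpansions.

(** * Residues modulo M(0) and the lower bound *)

Section Residues.
Context {R : realType} {alpha : R[i]}.
Hypothesis alpha_alg : algebraic_number alpha.
Local Notation M := (primitive_minpoly alpha).

(** The polynomial [k - X h] vanishes at [alpha], so it is a multiple of [M]; evaluating at 0 gives
    the claim. *)
Lemma minpoly0_dvd (k : int) (h : {poly int}) :
  k%:~R = alpha * (map_poly intr h).[alpha] -> (M.[0] %| k)%Z.
Proof.
move=> Dk; have [|q Dq] := minpoly_int_dvdp alpha_alg (k%:P - 'X * h).
  by rewrite rmorphB rmorphM /= map_polyC map_polyX /root !hornerE /= Dk subrr.
have := congr1 (fun p : {poly int} => p.[0]) Dq.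
by rewrite !hornerE => ->; rewrite dvdz_mulr.
Qed.

Lemma generates_card_ge (T : {fset R[i]}) :
  generates alpha T -> (`|M.[0]| <= #|` T|)%N.
Proof.
rewrite /generates => genT; set m := `|M.[0]|%N.
have TZ d : [set` T]%classic d -> adjoin (@complex_int R) alpha d.
  by rewrite genT; apply: adjoin1.
have /choice[f fP] (r : 'I_m) : exists d, d \in T /\ exists h,
    (r : int)%:~R = d + alpha * (map_poly intr h).[alpha].
  apply: (adjoin_first_digit _ _ TZ); rewrite -genT; apply: adjoin1.
  by exists (r : int).
(* If [r] and [s] share a first digit, their difference is [alpha] times an element of Z[alpha],
   while both are below [m]. *)
have f_inj : injective f.
  move=> r s frs; have [_ [h Dr]] := fP r; have [_ [k Ds]] := fP s.
  have : (M.[0] %| (r : int) - (s : int))%Z.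
    apply: (minpoly0_dvd _ (h - k)).
    by rewrite rmorphB /= Dr Ds frs rmorphB /= !hornerE; ring.
  rewrite -eqz_mod_dvd -(modz_abs r%:Z) -(modz_abs s%:Z) -/m !modz_nat !modn_small //.
  by move=> /eqP[] /val_inj.
have := uniq_leq_size (s1 := codom f) (s2 := enum_fset T).
rewrite size_codom card_ord; apply.
  by rewrite /codom map_inj_uniq ?enum_uniq.
by move=> _ /codomP[r ->]; have [] := fP r.
Qed.

End Residues.

(** * Growth under multiplication by X, and minimal elements *)

Section Descent.
Context {R : realType}.
Implicit Types (rs : seq R[i]) (g h : {poly int}).

(** The difference of the two sides is a sum of terms (|z| - 2)|h(z)|, all nonnegative; it vanishes
    only when every h(z) does. *)
Lemma conj_norm_mulX_gt rs h : (forall z, z \in rs -> 2 < `|z|) ->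
  conj_norm rs h != 0 -> 2 * conj_norm rs h < conj_norm rs ('X * h).
Proof.
move=> rs2 nzh; rewrite -subr_gt0.
have -> : conj_norm rs ('X * h) - 2 * conj_norm rs h =
    \sum_(z <- rs) (`|z| - 2) * `|(map_poly intr h).[z]|.
  rewrite mulr_sumr -sumrB; apply: eq_bigr => z _.
  by rewrite rmorphM /= map_polyX !hornerE normrM mulrBl.
have ge0 z : z \in rs -> 0 <= (`|z| - 2) * `|(map_poly intr h).[z]|.
  by move=> /rs2/ltW z2; rewrite mulr_ge0 // subr_ge0.
rewrite lt_neqAle big_seq sumr_ge0 // andbT eq_sym.
apply: contra nzh; rewrite psumr_eq0 // => /allP h0.
rewrite /conj_norm psumr_eq0 //; apply/allP => z zrs /=.
have := h0 z zrs; rewrite zrs /= mulf_eq0 subr_eq0 => /orP[|//].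
by have := rs2 z zrs; rewrite lt_neqAle eq_sym => /andP[/negPf ->].
Qed.

Lemma conj_norm_min rs (P : {poly int} -> Prop) :
  well_founded (fun g h => conj_norm rs g < conj_norm rs h) ->
  (exists g, P g) ->
  exists2 g, P g & forall h, P h -> conj_norm rs g <= conj_norm rs h.
Proof.
move=> wf [g]; elim/(well_founded_ind wf): g => g IH Pg.
have [[h [ltg Ph]]|nex] :=
  pselect (exists h, conj_norm rs h < conj_norm rs g /\ P h).
  exact: IH ltg Ph.
(* The order on [R[i]] is partial, but norms are real and hence comparable. *)
exists g => // h Ph; rewrite real_leNgt ?ger0_real ?conj_norm_ge0 //.
by apply/negP => lth; apply: nex; exists h.
Qed.

End Descent.

(** * Minimal digits and termination of the expansion *)

Theorem theorem2 (R : realType) (alpha : R[i])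
    (alpha_int : algebraic_integer alpha)
    (conj_gt2 : forall beta : R[i], conjugate alpha beta -> 2 < `|beta|) :
  calF `|(primitive_minpoly alpha).[0]|%N alpha.
Proof.
have alpha_alg := algebraic_integer_number alpha_int.
set M := primitive_minpoly alpha; set m := `|M.[0]|%N.
have monM : M \is monic := minpoly_monic alpha_alg alpha_int.
have [rs DM] := closed_field_poly_normal (map_poly intr M : {poly R[i]}).
have {}DM : map_poly intr M = \prod_(z <- rs) ('X - z%:P) :> {poly R[i]}.
  by rewrite {1}DM (monicP (monic_map _ monM)) scale1r.
have urs : uniq rs.
  by rewrite -separable_prod_XsubC -DM; apply: minpoly_separable.
have rsP z : (z \in rs) = root (map_poly intr M) z.
  by rewrite DM root_prod_XsubC.
have rs2 z : z \in rs -> 2 < `|z| by rewrite rsP; apply: conj_gt2.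
have alpha_rs : alpha \in rs.
  by rewrite rsP; have [] := primitive_minpolyP alpha_alg.
have wf := conj_norm_wf _ _ monM urs DM.
have M0 : M.[0] != 0.
  apply/eqP => M0; have: (0 : R[i]) \in rs.
    rewrite rsP /root -(rmorph0 (intr : {rmorphism int -> R[i]})).
    by rewrite horner_map M0 rmorph0.
  by move=> /rs2; rewrite normr0 lt_gtF ?ltr0n.
have /choice[d dP] (r : nat) : exists g : {poly int},
    (g.[0] == r%:Z %[mod M.[0]])%Z /\
    forall h : {poly int}, (h.[0] == r%:Z %[mod M.[0]])%Z ->
      conj_norm rs g <= conj_norm rs h.
  have [|g] := conj_norm_min rs
    (fun g : {poly int} => (g.[0] == r%:Z %[mod M.[0]])%Z) wf.
    by exists (r%:Z)%:P; rewrite hornerC.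
  by exists g.
(* By construction [S] has at most [m] elements; equality will follow from the lower bound on
   generating sets. *)
pose S := [fset z in [seq (map_poly intr (d r)).[alpha] | r <- iota 0 m]]%fset.
have genS : generates alpha S.
  apply/seteqP; split=> z; last first.
    apply: adjoin_intS => x /=; rewrite inE => /mapP[r _ ->].
    by apply/adjoin_intP; exists (d r).
  move=> /adjoin_intP[g ->].
  elim/(well_founded_ind wf): g {z} => g IH.
  pose r := `|(g.[0] %% M.[0])%Z|%N.
  have Dr : r%:Z = (g.[0] %% M.[0])%Z by rewrite gez0_abs // modz_ge0.
  have ltrm : (r < m)%N by rewrite -ltz_nat Dr abszE ltz_mod.
  have gr : (g.[0] == r%:Z %[mod M.[0]])%Z by rewrite Dr modz_mod.
  have [dr /(_ g gr) mindr] := dP r.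
  have Sd : [set` S]%classic (map_poly intr (d r)).[alpha].
    by rewrite /= inE; apply/mapP; exists r; rewrite // mem_iota.
  have /dvdzP[k Dk] : (M.[0] %| g.[0] - (d r).[0])%Z.
    by rewrite -eqz_mod_dvd (eqP gr) eq_sym.
  (* The choice of [k] cancels the constant term, so [X] can be factored out. *)
  have /factor_theorem[h Dh] : root (g - d r - k *: M) 0.
    by rewrite /root !hornerE Dk subrr.
  rewrite subr0 mulrC in Dh.
  have Dg z : z \in rs -> (map_poly intr g).[z] =
      (map_poly intr (d r)).[z] + z * (map_poly intr h).[z].
    rewrite rsP => /rootP Mz.
    have -> : g = d r + k *: M + 'X * h by rewrite -Dh; ring.
    rewrite !rmorphD rmorphM /= map_polyZ map_polyX !hornerE Mz.
    by rewrite mulr0 addr0.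
  rewrite Dg //; have [h0|nzh] := eqVneq (conj_norm rs h) 0.
    (* Since [alpha] is one of the roots, h(alpha) = 0 and the expansion stops at this digit. *)
    by rewrite (conj_norm_eq0 _ _ _ h0 alpha_rs) mulr0 addr0; apply: adjoin1.
  apply: adjoin_cons => //; apply: IH.
  rewrite -(ltr_pM2l (ltr0n _ 2 : 0 < 2 :> R[i])).
  apply: lt_le_trans (conj_norm_mulX_gt _ _ rs2 nzh) _.
  rewrite mulr_natl mulr2n.
  apply: le_trans (lerD (lexx (conj_norm rs g)) mindr).
  rewrite -big_split /= /conj_norm big_seq [leRHS]big_seq.
  (* At each root, the triangle inequality is applied to z h(z) = g(z) - d_r(z). *)
  apply: ler_sum => z zrs; rewrite (Dg z zrs).
  rewrite rmorphM /= map_polyX !hornerE.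
  set a := (map_poly intr (d r)).[z]; set b := z * _.
  by have := ler_normB (a + b) a; rewrite addrAC subrr add0r.
split=> //; exists S.
have leS : (#|` S| <= m)%N.
  by rewrite card_fseq (leq_trans (size_undup _)) // size_map size_iota.
have minS := generates_card_ge alpha_alg.
split=> // [T genT|]; first exact: leq_trans leS (minS T genT).
by apply/eqP; rewrite eqn_leq leS minS.
Qed.
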